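(* Let $X\subseteq\mathbb{R}^n$ be non-empty, closed and convex, with $n=\sum_{i=1}^N n_i$, and consider the jointly convex generalized Nash equilibrium problem with shared constraint set $X$ and loss functions $$\theta_i(x)=\tfrac12 x_i^T A_{ii}x_i+\sum_{l=1,\,l\ne i}^N x_l^T A_{li}x_i,\qquad i=1,\dots,N,\quad x=(x_i)_{i=1}^N\in\mathbb{R}^n,$$ where $A_{li}\in\mathbb{R}^{n_l\times n_i}$ and each $A_{ii}$ is symmetric. Suppose that the matrix $$C=\begin{bmatrix}\frac12A_{11}&A_{12}&\cdots&A_{1N}\\ A_{21}&\frac12A_{22}&\cdots&A_{2N}\\ \vdots&\vdots&\ddots&\vdots\\ A_{N1}&A_{N2}&\cdots&\frac12A_{NN}\end{bmatrix}$$ is positive definite (i.e. $x^TCx>0$ for all $x\neq0$; $C$ need not be symmetric), and let $\delta>0$ be the smallest eigenvalue of $C+C^T$. Suppose the set $X^*$ of normalized Nash equilibria fulfills the weak sharpness property with constant $\gamma>0$. Let $a\in(0,\delta]$, let $\epsilon>0$, and let $(r_k)$ be a sequence of positive reals with $\liminf_{k\to\infty}r_k>0$ and $\frac1{r_k}\in(0,\epsilon)$ for every $k$. Let $x_0\in X$ be an initial point and let $(x_k)$ be a sequence in $X$ generated from $x_0$ by the proximal point algorithm, i.e. for every $k\ge0$ $$\psi_a(x_{k+1},z)-\frac1{r_k}\langle z-x_{k+1},\,x_{k+1}-x_k\rangle\le0\quad\text{for all }z\in X.$$ Then the algorithm converges in $k_0+1$ iterations, that is, there is an integer $k_0\ge0$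 such that $x_k\in X^*$ for all $k\ge k_0+1$, where $$k_0\le\frac{d(x_0,X^* )^2\,\epsilon^2}{\gamma^2}.$$
   Context: Setting (jointly convex generalized Nash equilibrium problem). There are $N$ players; player $i$ controls $x_i\in\mathbb{R}^{n_i}$, and $x=(x_1,\dots,x_N)=(x_{-i},x_i)\in\mathbb{R}^n$, where $x_{-i}\in\mathbb{R}^{n-n_i}$ collects the strategies of all players other than $i$. Given $x_{-i}$, player $i$ minimizes $\theta_i(x_{-i},\cdot)$ over $K_i(x_{-i})=\{x_i\in\mathbb{R}^{n_i} : (x_{-i},x_i)\in X\}$. (Subscripts $k$ on the sequence $(x_k)$ in the claim are iteration indices, with $x_k\in X\subseteq\mathbb{R}^n$.) Define $F:\mathbb{R}^n\to\mathbb{R}^n$ by $F(x)=(\nabla_{x_1}\theta_1(x),\dots,\nabla_{x_N}\theta_N(x))$, where $\nabla_{x_i}$ is the partial gradient with respect to $x_i$. A normalized Nash equilibrium is a point $x^*\in X$ with $\langle F(x^* ),y-x^*\rangle\ge 0$ for all $y\in X$; $X^*$ denotes the set of all of them. For $a>0$, the regularized Nikaido-Isoda function is $$\psi_a(x,y)=\sum_{i=1}^N\Big[\theta_i(x_{-i},x_i)-\theta_i(x_{-i},y_i)-\tfrac a2\|x_i-y_i\|^2\Big].$$ For a set $S\subseteq\mathbb{R}^n$, $S^\circ=\{v : \langle v,z\rangle\le 0\ \forall z\in S\}$ is its polar; for a closed convex set $S$ and $x\in S$, the normal cone is $N_S(x)=(S-x)^\circ=\{v:\langle v,z-x\rangle\le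 0\ \forall z\in S\}$ and the tangent cone is $T_S(x)=[N_S(x)]^\circ$. $B$ is the (closed) unit ball of $\mathbb{R}^n$, $\|\cdot\|$ is the Euclidean norm, and $d(x,S)=\inf_{z\in S}\|x-z\|$. Weak sharpness property with constant $\gamma>0$: $$-F(x^* )+\gamma B\ \subseteq\ \bigcap_{x\in X^*}\big[T_X(x)\cap N_{X^*}(x)\big]^\circ\quad\text{for all }x^*\in X^* .$$ *)

(* Defs.v *)
From HB Require Import structures.
From mathcomp Require Import all_boot all_order all_algebra.
From mathcomp Require Import all_classical all_reals all_analysis.

Set Implicit Arguments.
Unset Strict Implicit.
Unset Printing Implicit Defensive.

Import Order.TTheory GRing.Theory Num.Theory.
Import numFieldNormedType.Exports.

Local Open Scope classical_set_scope.
Local Open Scope ring_scope.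

Section Euclidean.
Context {R : realType} {m : nat}.
Implicit Types (x y v : 'cV[R]_m) (S : set 'cV[R]_m).

Definition dotv x y : R := (x^T *m y) 0 0.

(* The library norm `|x| on matrices is the max norm, hence this one. *)
Definition eucl_norm x : R := Num.sqrt (dotv x x).

Definition eucl_unit_ball : set 'cV[R]_m := [set b | eucl_norm b <= 1].

(* Junk value 0 when S is empty. *)
Definition eucl_dist x S : R := inf [set eucl_norm (x - z) | z in S].

Definition polar S : set 'cV[R]_m := [set v | forall z, S z -> dotv v z <= 0].

(* Meaningful for x in S only. *)
Definition normal_cone S x : set 'cV[R]_m := polar [set z - x | z in S].

Definition tangent_cone S x : set 'cV[R]_m := polar (normal_cone S x).

Definition grad (f : 'cV[R]_m -> R) x : 'cV[R]_m :=
  \col_(j < m) 'D_(delta_mx j 0) f x.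

(* No symmetry of M is required. *)
Definition positive_definite (M : 'M[R]_m) : Prop :=
  forall x, x != 0 -> 0 < (x^T *m M *m x) 0 0.

Definition smallest_eigenvalue (M : 'M[R]_m) (d : R) : Prop :=
  eigenvalue M d /\ (forall mu : R, eigenvalue M mu -> d <= mu).

End Euclidean.

Section Game.
Context {R : realType} {N : nat} {n_ : 'I_N -> nat}.
(* A profile is a vector of R^n, n = \sum_i n_ i; the strategy of player i is
   its i-th block, [submxcol x i]. *)
Local Notation profile := 'cV[R]_(\sum_(i < N) n_ i).
Implicit Types (x y z : profile) (X : set profile) (theta : 'I_N -> profile -> R).

(* (x_{-i}, u) *)
Definition deviate x (i : 'I_N) (u : 'cV[R]_(n_ i)) : profile :=
  \mxcol_(j < N) dfwith (fun j => submxcol x j) i u j.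

Definition pseudo_gradient theta x : profile :=
  \mxcol_(i < N) grad (fun u => theta i (deviate x u)) (submxcol x i).

Definition normalized_NE theta X : set profile :=
  [set xs | X xs /\
    forall y, X y -> 0 <= dotv (pseudo_gradient theta xs) (y - xs)].

Definition nikaido_isoda theta (a : R) x y : R :=
  \sum_(i < N) (theta i x - theta i (deviate x (submxcol y i))
    - a / 2 * eucl_norm (submxcol x i - submxcol y i) ^+ 2).

Definition weak_sharp theta X (gamma : R) : Prop :=
  let Xs := normalized_NE theta X in
  forall xs, Xs xs ->
    [set - pseudo_gradient theta xs + gamma *: b | b in eucl_unit_ball] `<=`
    \bigcap_(x in Xs) polar (tangent_cone X x `&` normal_cone Xs x).

Definition proximal_point_sequence theta X (a : R) (r : nat -> R)
    (x_ : nat -> profile) : Prop :=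
  (forall k, X (x_ k)) /\
  forall k z, X z ->
    nikaido_isoda theta a (x_ k.+1) z
      - (r k)^-1 * dotv (z - x_ k.+1) (x_ k.+1 - x_ k) <= 0.

Definition quadratic_loss (A : forall i j, 'M[R]_(n_ i, n_ j))
    (i : 'I_N) x : R :=
  2^-1 * ((submxcol x i)^T *m A i i *m submxcol x i) 0 0
  + \sum_(l < N | l != i) ((submxcol x l)^T *m A l i *m submxcol x i) 0 0.

Definition coupling_mx (A : forall i j, 'M[R]_(n_ i, n_ j)) :
    'M[R]_(\sum_(i < N) n_ i) :=
  \mxblock_(i < N, j < N) (if i == j then 2^-1 *: A i j else A i j).

End Game.

(* Main.v *)
Require Import Defs.
From HB Require Import structures.
From mathcomp Require Import all_boot all_order all_algebra.
From mathcomp Require Import all_classical all_reals all_analysis.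
From mathcomp Require Import ring lra.

Set Implicit Arguments.
Unset Strict Implicit.
Unset Printing Implicit Defensive.

Import Order.TTheory GRing.Theory Num.Theory.
Import numFieldNormedType.Exports.

Local Open Scope classical_set_scope.
Local Open Scope ring_scope.

(** The loss of each player is quadratic, so the pseudo-gradient is a linear map
    [x |-> G x]. The off-diagonal blocks of [G] are those of [C^T] and its
    diagonal blocks are twice those of [C]; since the diagonal blocks of a
    positive definite matrix are positive definite, [G] is positive definite
    ([positive_definite_pseudo_gradient]). Normalized equilibria are the
    solutions on [X] of the variational inequality of [G], so there is at most
    one ([vi_solutions_singleton]).

    Expanding the losses shows that the Nikaido-Isoda function is
    [- <G x, y - x>] minus a quadratic form in [y - x]. Applied to points of [X]
    close to [x_ k.+1] on segments, the proximal inequality loses its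
    quadratic part and becomes
    [0 <= <G x_ k.+1 + (x_ k.+1 - x_ k) / r k, z - x_ k.+1>]
    ([proximal_point_vi_sequence]). Everything else follows from this form.

    The equilibrium exists because the sequence itself converges to one: [G] is
    coercive, which bounds the lengths of the steps by a geometric sequence, and
    the limit of the inequalities of the steps is the variational inequality
    ([proximal_limit_vi_solution]).

    Let [xs] be the equilibrium. Its singleton has the whole space as normal
    cone, so weak sharpness reduces to [gamma |x - xs| <= <G xs, x - xs>] on [X]
    ([weak_sharp_singleton]). Against monotonicity and the proximal inequality at
    [z = xs] this forces every step that does not land on [xs] to be longer than
    [gamma / eps] ([proximal_step_lower_bound]). But each step decreases the
    squared distance to [xs] by at least its own squared length
    ([proximal_fejer]), so at most [|x_ 0 - xs|^2 eps^2 / gamma^2] steps miss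
    [xs], and once reached [xs] is never left ([proximal_finite_termination]). *)

(** * Euclidean geometry and coercive forms *)

(* This joins the complete and the normed structures of matrices. *)
HB.instance Definition _ (R : realType) m n := Complete.on 'M[R]_(m, n).

Section EuclideanTheory.
Context {R : realType} {m : nat}.
Implicit Types (x y z v w : 'cV[R]_m) (t : R).

Lemma dotvE x y : dotv x y = \sum_i x i 0 * y i 0.
Proof. by rewrite /dotv mxE; apply: eq_bigr => i _; rewrite mxE. Qed.

Lemma dotvC x y : dotv x y = dotv y x.
Proof. by rewrite !dotvE; apply: eq_bigr => i _; rewrite mulrC. Qed.

Lemma dotvDr x y z : dotv x (y + z) = dotv x y + dotv x z.
Proof. by rewrite /dotv mulmxDr mxE. Qed.

Lemma dotvZr t x y : dotv x (t *: y) = t * dotv x y.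
Proof. by rewrite /dotv -scalemxAr mxE. Qed.

Lemma dotvNr x y : dotv x (- y) = - dotv x y.
Proof. by rewrite /dotv mulmxN mxE. Qed.

Lemma dotvDl x y z : dotv (y + z) x = dotv y x + dotv z x.
Proof. by rewrite dotvC dotvDr !(dotvC x). Qed.

Lemma dotvZl t x y : dotv (t *: y) x = t * dotv y x.
Proof. by rewrite dotvC dotvZr dotvC. Qed.

Lemma dotvNl x y : dotv (- y) x = - dotv y x.
Proof. by rewrite dotvC dotvNr dotvC. Qed.

Definition dotv_linear := (dotvDl, dotvDr, dotvNl, dotvNr, dotvZl, dotvZr).

Lemma dotv0 x : dotv x 0 = 0.
Proof. by rewrite -(scale0r x) dotvZr mul0r. Qed.

Lemma dotv_delta x i : dotv x (delta_mx i 0) = x i 0.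
Proof.
rewrite dotvE (bigD1 i) //= big1 ?addr0 => [|j ji]; rewrite mxE.
  by rewrite !eqxx mulr1.
by rewrite (negPf ji) mulr0.
Qed.

Lemma dotv_ge0 x : 0 <= dotv x x.
Proof. by rewrite dotvE sumr_ge0 // => i _; rewrite -expr2 sqr_ge0. Qed.

Lemma sqr_coord_le x i : x i 0 ^+ 2 <= dotv x x.
Proof.
rewrite dotvE (bigD1 i) //= -expr2 lerDl sumr_ge0 // => j _.
by rewrite -expr2 sqr_ge0.
Qed.

Lemma dotv_eq0 x : (dotv x x == 0) = (x == 0).
Proof.
apply/eqP/eqP => [x0|->]; last exact: dotv0.
apply/matrixP => i j; rewrite ord1 mxE; apply/eqP; rewrite -sqrf_eq0 eq_le.
by rewrite sqr_ge0 andbT -x0 sqr_coord_le.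
Qed.

Lemma eucl_norm_ge0 x : 0 <= eucl_norm x.
Proof. exact: sqrtr_ge0. Qed.

Lemma sqr_eucl_norm x : eucl_norm x ^+ 2 = dotv x x.
Proof. by rewrite sqr_sqrtr // dotv_ge0. Qed.

Lemma eucl_normZ t x : eucl_norm (t *: x) = `|t| * eucl_norm x.
Proof.
by rewrite /eucl_norm dotvZl dotvZr mulrA -expr2 sqrtrM ?sqr_ge0 // sqrtr_sqr.
Qed.

Lemma eucl_norm_gt0 x : (0 < eucl_norm x) = (x != 0).
Proof. by rewrite sqrtr_gt0 lt_neqAle dotv_ge0 andbT eq_sym dotv_eq0. Qed.

Lemma coord_le_eucl_norm x i : `|x i 0| <= eucl_norm x.
Proof. by rewrite -sqrtr_sqr ler_wsqrtr // sqr_coord_le. Qed.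

Lemma norm_le_eucl_norm x : `|x| <= eucl_norm x.
Proof.
rewrite {1}/Num.norm /= mx_normrE bigmax_le ?eucl_norm_ge0 // => -[i j] _ /=.
by rewrite ord1 coord_le_eucl_norm.
Qed.

Lemma dotv_mulmxr (n : nat) (M : 'M[R]_(m, n)) x (y : 'cV[R]_n) :
  dotv x (M *m y) = dotv (M^T *m x) y.
Proof. by rewrite /dotv trmx_mul trmxK mulmxA. Qed.

(** The quadratic polynomial [t |-> <x + t y, S (x + t y)>] is nonnegative, so
    its discriminant is not positive. *)
Lemma cauchy_schwarz_form (S : 'M[R]_m) x y :
  S^T = S -> (forall v, 0 <= dotv v (S *m v)) ->
  dotv x (S *m y) ^+ 2 <= dotv x (S *m x) * dotv y (S *m y).
Proof.
move=> ST S_ge0.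
have Sxy t : 0 <= dotv x (S *m x) + 2 * t * dotv x (S *m y)
                  + t ^+ 2 * dotv y (S *m y).
  have yx : dotv y (S *m x) = dotv x (S *m y) by rewrite dotv_mulmxr ST dotvC.
  have := S_ge0 (x + t *: y); rewrite mulmxDr -scalemxAr !dotv_linear yx; lra.
have := S_ge0 y; rewrite le_eqVlt eq_sym => /predU1P[y0|y_gt0].
  rewrite y0 mulr0; have [->|b0] := eqVneq (dotv x (S *m y)) 0.
    by rewrite expr0n.
  have := Sxy (- (dotv x (S *m x) + 1) / (2 * dotv x (S *m y))).
  rewrite y0 mulr0 addr0; set b := dotv x (S *m y) in b0 *.
  set d := dotv x (S *m x).
  have -> : d + 2 * (- (d + 1) / (2 * b)) * b = - 1 by field.
  lra.
have := Sxy (- (dotv x (S *m y) / dotv y (S *m y))).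
set b := dotv x (S *m y); set c := dotv y (S *m y) in y_gt0 *.
set d := dotv x (S *m x).
have -> : d + 2 * - (b / c) * b + (- (b / c)) ^+ 2 * c = (d * c - b ^+ 2) / c.
  by field; rewrite gt_eqF.
by rewrite pmulr_lge0 ?invr_gt0 // subr_ge0.
Qed.

Lemma cauchy_schwarz x y : dotv x y <= eucl_norm x * eucl_norm y.
Proof.
have [?|xy_ge0] := ltP (dotv x y) 0.
  by rewrite ltW // (lt_le_trans (y := 0)) // mulr_ge0 ?eucl_norm_ge0.
rewrite -(@ler_pXn2r _ 2) ?nnegrE ?mulr_ge0 ?eucl_norm_ge0 // exprMn.
rewrite !sqr_eucl_norm.
have := @cauchy_schwarz_form 1%:M x y; rewrite !mul1mx; apply.
  exact: trmx1.
by move=> v; rewrite mul1mx dotv_ge0.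
Qed.

Lemma cvg_dotv (T : Type) (F : set_system T) {FF : Filter F}
    (u v : T -> 'cV[R]_m) x y :
  (forall i, u t i 0 @[t --> F] --> x i 0) ->
  (forall i, v t i 0 @[t --> F] --> y i 0) ->
  dotv (u t) (v t) @[t --> F] --> dotv x y.
Proof.
move=> ux vy; rewrite dotvE.
under eq_fun do rewrite dotvE.
apply: cvg_big => [|i _]; first exact: add_continuous.
exact: cvgM.
Qed.

Lemma dotv_mulmx_bounded (P : 'M[R]_m) :
  exists2 K, 0 <= K & forall x, dotv x (P *m x) <= K * dotv x x.
Proof.
exists (\sum_i \sum_j `|P i j|).
  by rewrite sumr_ge0 // => i _; rewrite sumr_ge0.
move=> x; rewrite {1}dotvE mulr_suml ler_sum // => i _.
rewrite mxE mulr_sumr mulr_suml ler_sum // => j _.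
rewrite mulrCA (le_trans (ler_norm _)) // !normrM ler_wpM2l //.
by rewrite -sqr_eucl_norm expr2 ler_pM ?coord_le_eucl_norm.
Qed.

(** With [S = M + M^T] and [P = S^-1], Cauchy-Schwarz for the form of [S] gives
    [<x, x>^2 = <x, S P x>^2 <= <x, S x> <P x, x>], and [<P x, x>] is at most a
    constant times [<x, x>]; this yields the modulus without a spectral
    theorem. *)
Lemma positive_definite_coercive (M : 'M[R]_m) :
  positive_definite M ->
  exists2 mu, 0 < mu & forall x, mu * dotv x x <= dotv x (M *m x).
Proof.
move=> Mpd; have M_gt0 x : x != 0 -> 0 < dotv x (M *m x).
  by move=> /Mpd; rewrite /dotv mulmxA.
pose S := M + M^T.
have Sx x : dotv x (S *m x) = 2 * dotv x (M *m x).
  rewrite mulmxDl dotvDr [dotv x (M^T *m x)]dotv_mulmxr trmxK.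
  by rewrite [dotv (M *m x) x]dotvC mulr_natl mulr2n.
have S_ge0 x : 0 <= dotv x (S *m x).
  have [->|/M_gt0 x0] := eqVneq x 0; first by rewrite mulmx0 dotv0.
  by rewrite Sx mulr_ge0 // ltW.
have ST : S^T = S by rewrite raddfD /= trmxK addrC.
have Su : S \in unitmx.
  rewrite -row_free_unit; apply/inj_row_free => v vS0.
  apply/eqP; rewrite -trmx_eq0; apply/negPn/negP => /M_gt0.
  suff : dotv v^T (S *m v^T) = 0 by rewrite Sx; lra.
  by rewrite -{1}ST -trmx_mul vS0 trmx0 dotv0.
have [K K_ge0 PK] := dotv_mulmx_bounded (invmx S).
exists (2 * (K + 1))^-1 => [|x]; first by rewrite invr_gt0; lra.
have [->|x0] := eqVneq x 0; first by rewrite mulmx0 !dotv0 mulr0.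
have x_gt0 : 0 < dotv x x by rewrite lt_neqAle eq_sym dotv_eq0 x0 dotv_ge0.
have := cauchy_schwarz_form x (invmx S *m x) ST S_ge0.
rewrite mulKVmx // [dotv (_ *m _) x]dotvC Sx => CS.
rewrite mulrC ler_pdivrMr; last lra.
have := PK x; have := M_gt0 _ x0; nra.
Qed.

End EuclideanTheory.

(** * Proximal sequences of monotone variational inequalities *)

Section VariationalInequality.
Context {R : realType} {m : nat}.
Implicit Types (x y z : 'cV[R]_m) (X : set 'cV[R]_m).

(** At the pseudo-gradient of a game these are the normalized equilibria. *)
Definition vi_solutions (F : 'cV[R]_m -> 'cV[R]_m) X : set 'cV[R]_m :=
  [set x | X x /\ forall y, X y -> 0 <= dotv (F x) (y - x)].

Definition monotone_map (F : 'cV[R]_m -> 'cV[R]_m) : Prop :=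
  forall x y, 0 <= dotv (F x - F y) (x - y).

(** First-order form of the proximal step, with [c k] for the inverse of the
    step parameter. *)
Definition proximal_vi_sequence (F : 'cV[R]_m -> 'cV[R]_m) X
    (c : nat -> R) (x_ : nat -> 'cV[R]_m) : Prop :=
  (forall k, X (x_ k)) /\
  forall k z, X z ->
    0 <= dotv (F (x_ k.+1) + c k *: (x_ k.+1 - x_ k)) (z - x_ k.+1).

(** The step inequality at [z = xs] and monotonicity make the angle at
    [x_ k.+1] between [x_ k] and [xs] at least a right angle; this is the law of
    cosines. *)
Lemma proximal_fejer (F : 'cV[R]_m -> 'cV[R]_m) X (c : nat -> R)
    (x_ : nat -> 'cV[R]_m) xs k :
  monotone_map F -> (forall k, 0 < c k) -> proximal_vi_sequence F X c x_ ->
  vi_solutions F X xs ->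
  dotv (x_ k.+1 - x_ k) (x_ k.+1 - x_ k) + dotv (x_ k.+1 - xs) (x_ k.+1 - xs)
  <= dotv (x_ k - xs) (x_ k - xs).
Proof.
move=> Fmono c_gt0 [Xx step] [Xxs xsP].
have := step k _ Xxs; have := xsP _ (Xx k.+1); have := Fmono (x_ k.+1) xs.
have := c_gt0 k; move: (c k) => t t_gt0.
rewrite !dotv_linear => H1 H2 H3.
have := dotvC (x_ k.+1) (x_ k); have := dotvC xs (x_ k).
have := dotvC xs (x_ k.+1) => E1 E2 E3.
have : 0 <= t * (dotv (x_ k.+1 - x_ k) (xs - x_ k.+1)).
  rewrite !dotv_linear; nra.
rewrite pmulr_rge0 // !dotv_linear; lra.
Qed.

Definition sharp_at (F : 'cV[R]_m -> 'cV[R]_m) X (gamma : R) xs : Prop :=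
  forall x, X x -> gamma * eucl_norm (x - xs) <= dotv (F xs) (x - xs).

(** With [y = x_ k.+1] and [F] monotone, the chain is
    [gamma |y - xs| <= <F xs, y - xs> <= <F y, y - xs>
     <= c k <y - x_ k, xs - y> <= c k |y - x_ k| |y - xs|]. *)
Lemma proximal_step_lower_bound (F : 'cV[R]_m -> 'cV[R]_m) X (c : nat -> R)
    (x_ : nat -> 'cV[R]_m) xs gamma k :
  monotone_map F -> (forall k, 0 < c k) -> proximal_vi_sequence F X c x_ ->
  X xs -> sharp_at F X gamma xs -> x_ k.+1 != xs ->
  gamma <= c k * eucl_norm (x_ k.+1 - x_ k).
Proof.
move=> Fmono c_gt0 [Xx step] Xxs sharp.
rewrite -subr_eq0 -eucl_norm_gt0 => d_gt0.
rewrite -(ler_pM2r d_gt0) (le_trans (sharp _ (Xx _))) //.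
have := step k _ Xxs; have := Fmono (x_ k.+1) xs.
have := cauchy_schwarz (x_ k.+1 - x_ k) (xs - x_ k.+1).
have -> : eucl_norm (xs - x_ k.+1) = eucl_norm (x_ k.+1 - xs).
  by rewrite /eucl_norm -[xs - _]opprB dotvNl dotvNr opprK.
rewrite -mulrA -(ler_pM2l (c_gt0 k)) !dotv_linear; lra.
Qed.

(** Each step that misses [xs] costs the squared distance to [xs] the fixed
    amount [gamma ^+ 2 / eps ^+ 2], and [xs] is absorbing; [k0.+1] is the first
    positive index at which [xs] is reached. *)
Lemma proximal_finite_termination (F : 'cV[R]_m -> 'cV[R]_m) X (c : nat -> R)
    (x_ : nat -> 'cV[R]_m) xs (gamma eps : R) :
  monotone_map F -> 0 < gamma -> (forall k, 0 < c k < eps) ->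
  proximal_vi_sequence F X c x_ ->
  vi_solutions F X xs -> sharp_at F X gamma xs ->
  exists k0 : nat, (forall k, (k0 < k)%N -> x_ k = xs) /\
    k0%:R <= eucl_norm (x_ 0%N - xs) ^+ 2 * eps ^+ 2 / gamma ^+ 2.
Proof.
move=> Fmono gamma_gt0 c_bnd prox xsP sharp.
have c_gt0 k : 0 < c k by have /andP[] := c_bnd k.
have eps_gt0 : 0 < eps by have /andP[/lt_trans h /h] := c_bnd 0%N.
pose D k := dotv (x_ k - xs) (x_ k - xs).
have D_ge0 k : 0 <= D k by exact: dotv_ge0.
pose q := gamma ^+ 2 / eps ^+ 2.
have q_gt0 : 0 < q by rewrite divr_gt0 ?exprn_gt0.
have fejer k := proximal_fejer k Fmono c_gt0 prox xsP.
have decr k : x_ k.+1 != xs -> q + D k.+1 <= D k.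
  move=> /(proximal_step_lower_bound Fmono c_gt0 prox xsP.1 sharp) gamma_le.
  rewrite (le_trans _ (fejer k)) // lerD2r ler_pdivrMr ?exprn_gt0 //.
  rewrite -sqr_eucl_norm -exprMn ler_pXn2r ?nnegrE ?mulr_ge0 ?eucl_norm_ge0 //;
    try exact: ltW.
  rewrite (le_trans gamma_le) // mulrC ler_wpM2l ?eucl_norm_ge0 // ltW //.
  by have /andP[] := c_bnd k.
have D0 k : x_ k = xs -> D k.+1 = 0.
  move=> xk; apply/eqP; rewrite eq_le D_ge0 andbT.
  have := fejer k; rewrite xk subrr dotv0 /D.
  have := dotv_ge0 (x_ k.+1 - xs); lra.
have stay k : x_ k = xs -> x_ k.+1 = xs.
  by move=> /D0/eqP; rewrite dotv_eq0 subr_eq0 => /eqP.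
have count n : (forall k, (k < n)%N -> x_ k.+1 != xs) -> n%:R * q <= D 0%N.
  move=> before; suff : n%:R * q + D n <= D 0%N by have := D_ge0 n; lra.
  elim: n before => [_|n IH before]; first by rewrite mul0r add0r.
  have := decr n (before n (ltnSn n)).
  have := IH (fun k kn => before k (ltnW kn)).
  rewrite -natr1; lra.
have ex_n : exists n, x_ n.+1 == xs.
  apply: contrapT => /forallNP never.
  have := count (Num.truncn (D 0%N / q)).+1 (fun k _ => introN idP (never k)).
  by rewrite leNgt -ltr_pdivrMr // truncnS_gt.
exists (ex_minn ex_n); case: ex_minnP => k0 /eqP k0P k0min; split=> [k|].
  elim: k => // k IH; rewrite ltnS leq_eqVlt => /predU1P[<- //|/IH].
  exact: stay.
rewrite sqr_eucl_norm -mulrA -[eps ^+ 2 / _]invf_div ler_pdivlMr // count // => k.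
by rewrite ltnNge; apply: contra => /k0min.
Qed.

(** Testing two consecutive steps against each other and adding, the residuals
    [e k = c k * |x_ k.+1 - x_ k|] contract: [e k.+1 + mu * d k.+1 <= e k] with
    [d] the step lengths. Since [c k.+1 < eps], the ratio is at most
    [eps / (mu + eps)]. *)
Lemma proximal_residual_geometric (F : 'cV[R]_m -> 'cV[R]_m) X (c : nat -> R)
    (x_ : nat -> 'cV[R]_m) (mu eps : R) :
  0 < mu -> (forall x y, mu * dotv (x - y) (x - y) <= dotv (F x - F y) (x - y)) ->
  (forall k, 0 < c k < eps) -> proximal_vi_sequence F X c x_ ->
  exists E q, [/\ 0 <= E, 0 < q < 1,
    forall k, c k * eucl_norm (x_ k.+1 - x_ k) <= geometric E q k &
    forall k, mu * eucl_norm (x_ k.+2 - x_ k.+1) <= geometric E q k].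
Proof.
move=> mu_gt0 Fmu c_bnd [Xx step].
have c_gt0 k : 0 < c k by have /andP[] := c_bnd k.
have c_lt k : c k < eps by have /andP[] := c_bnd k.
have eps_gt0 : 0 < eps := lt_trans (c_gt0 0%N) (c_lt 0%N).
pose d k := eucl_norm (x_ k.+1 - x_ k).
have d_ge0 k : 0 <= d k by exact: eucl_norm_ge0.
have contract k : (mu + c k.+1) * d k.+1 <= c k * d k.
  have [d0|dpos] := leP (d k.+1) 0.
    have -> : d k.+1 = 0 by apply/eqP; rewrite eq_le d0 d_ge0.
    by rewrite mulr0 mulr_ge0 // ltW.
  rewrite -(ler_pM2r dpos) -mulrA -expr2 sqr_eucl_norm.
  have := cauchy_schwarz (x_ k.+1 - x_ k) (x_ k.+2 - x_ k.+1).
  rewrite -mulrA -(ler_pM2l (c_gt0 k)).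
  have := step k _ (Xx k.+2); have := step k.+1 _ (Xx k.+1).
  have := Fmu (x_ k.+2) (x_ k.+1).
  rewrite -/(d k) -/(d k.+1).
  move: (d k) (d k.+1) => d0 d1.
  have := dotvC (x_ k.+1) (x_ k.+2).
  rewrite !dotv_linear; lra.
pose q := eps / (mu + eps).
have q_gt0 : 0 < q by rewrite divr_gt0 // addr_gt0.
have q_lt1 : q < 1 by rewrite ltr_pdivrMr ?addr_gt0 // mul1r ltrDr.
have geo k : c k * d k <= geometric (c 0%N * d 0%N) q k.
  elim: k => [|k IH] /=; first by rewrite expr0 mulr1.
  rewrite exprS mulrCA (le_trans _ (ler_wpM2l (ltW q_gt0) IH)) //.
  rewrite (le_trans _ (ler_wpM2l (ltW q_gt0) (contract k))) //.
  rewrite mulrA ler_wpM2r // /q mulrAC ler_pdivlMr ?addr_gt0 //.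
  have := c_lt k.+1; nra.
exists (c 0%N * d 0%N), q; split => [||//|k].
- by rewrite mulr_ge0 // ltW.
- by rewrite q_gt0.
- rewrite (le_trans _ (geo k)) // (le_trans _ (contract k)) // ler_wpM2r ?d_ge0 //.
  by rewrite lerDl ltW.
Qed.

Lemma positive_definite_monotone (M : 'M[R]_m) :
  positive_definite M -> monotone_map (mulmx M).
Proof.
move=> Mpd x y; rewrite -mulmxBr dotvC.
have [->|/Mpd/ltW] := eqVneq (x - y) 0; first by rewrite mulmx0 dotv0.
by rewrite /dotv mulmxA.
Qed.

Lemma vi_solutions_singleton (M : 'M[R]_m) X xs :
  positive_definite M -> vi_solutions (mulmx M) X xs ->
  vi_solutions (mulmx M) X = [set xs].
Proof.
move=> Mpd xsP; apply/seteqP; split=> [x [Xx xP]|_ ->//]; apply/eqP.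
rewrite -subr_eq0; apply/negPn/negP => /Mpd.
have : dotv (x - xs) (M *m (x - xs)) <= 0; last by rewrite /dotv mulmxA; lra.
have := xP _ xsP.1; have := xsP.2 _ Xx.
rewrite -[xs - x]opprB mulmxBr [dotv (x - xs) _]dotvC !dotv_linear; lra.
Qed.

(** Instead of a contraction built from projections onto [X], the proximal
    sequence itself provides the solution: its step lengths are summable, and
    the inequality of each step passes to the limit because the residuals
    vanish. The lengths are bounded through [mu], not through the residuals,
    because [c k] may come arbitrarily close to [0]. *)
Lemma proximal_limit_vi_solution (M : 'M[R]_m) X (c : nat -> R)
    (x_ : nat -> 'cV[R]_m) (eps : R) :
  closed X -> positive_definite M -> (forall k, 0 < c k < eps) ->
  proximal_vi_sequence (mulmx M) X c x_ -> exists xs, vi_solutions (mulmx M) X xs.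
Proof.
move=> Xcl /positive_definite_coercive[mu mu_gt0 Mmu] c_bnd prox.
have Mmu2 x y : mu * dotv (x - y) (x - y) <= dotv (M *m x - M *m y) (x - y).
  by rewrite -mulmxBr [leRHS]dotvC.
have [E [q [E_ge0 /andP[q_gt0 q_lt1] resid steps]]] :=
  proximal_residual_geometric mu_gt0 Mmu2 c_bnd prox.
have [Xx step] := prox.
have q1 : `|q| < 1 by rewrite gtr0_norm.
(* The first step has no geometric bound, hence the shift. *)
pose u n := x_ n.+1.
have : cvgn (series (telescope u)).
  apply: normed_cvg; apply: (@series_le_cvg _ _ (geometric (E / mu) q)) => //.
  - by move=> n /=.
  - by move=> n /=; rewrite mulr_ge0 ?exprn_ge0 ?divr_ge0 // ltW.
  - move=> n; rewrite (le_trans (norm_le_eucl_norm _)) //=.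
    by rewrite mulrAC ler_pdivlMr // mulrC steps.
  - exact: is_cvg_geometric_series.
move=> /cvg_ex[/= s us].
have ul : u n @[n --> \oo] --> u 0%N + s.
  under eq_fun do rewrite eq_sum_telescope.
  by apply: cvgD => //; exact: cvg_cst.
move: (u 0%N + s) ul => l ul; exists l.
have ul_coord i : u n i 0 @[n --> \oo] --> l i 0.
  exact: (continuous_cvg _ (@coord_continuous _ _ _ i 0 l) ul).
split=> [|z Xz].
  by apply: (@closed_cvg _ _ _ _ u X Xcl _ l ul); apply: nearW => n; exact: Xx.
have resid_cvg i : (c n *: (x_ n.+1 - x_ n)) i 0 @[n --> \oo] --> (0 : R).
  apply: norm_cvg0.
  apply: (squeeze_cvgr _ (cvg_cst 0) (cvg_geometric E q1)).
  apply: nearW => n; rewrite normr_ge0 /= mxE normrM.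
  have /andP[c_gt0 _] := c_bnd n.
  by rewrite (le_trans _ (resid n)) // gtr0_norm // ler_pM2l ?coord_le_eucl_norm.
have : dotv (M *m u n + c n *: (x_ n.+1 - x_ n)) (z - u n) @[n --> \oo]
       --> dotv (M *m l + 0) (z - l).
  apply: cvg_dotv => i.
    rewrite mxE [X in _ + X]mxE; under eq_fun do rewrite mxE.
    apply: cvgD; last exact: resid_cvg.
    rewrite mxE; under eq_fun do rewrite mxE.
    apply: cvg_big => [|j _]; first exact: add_continuous.
    by apply: cvgM => //; exact: cvg_cst.
  rewrite !mxE; under eq_fun do rewrite !mxE.
  by apply: cvgB => //; exact: cvg_cst.
rewrite addr0 => /cvgr_to_ge; apply; apply: nearW => n.
exact: step.
Qed.

End VariationalInequality.

(** * First-order conditions along lines and segments *)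

Section LineDerivatives.
Context {R : realType} {m : nat}.

Lemma grad_quadratic (f : 'cV[R]_m -> R) (x g : 'cV[R]_m) (B : 'M[R]_m) :
  (forall w, f (x + w) = f x + dotv g w + dotv w (B *m w)) -> grad f x = g.
Proof.
move=> fx; apply/matrixP => j k; rewrite ord1 mxE -dotv_delta.
set v := delta_mx j 0; rewrite /derive; apply: cvg_lim => //.
have : dotv g v + h * dotv v (B *m v) @[h --> (0 : R)^'] --> dotv g v.
  rewrite -[X in _ --> X]addr0 -[X in _ + X](mul0r (dotv v (B *m v))).
  apply: cvgD; first exact: cvg_cst.
  apply: cvgM; last exact: cvg_cst.
  exact: cvg_within.
apply: cvg_trans; apply: near_eq_cvg; near=> h.
have h0 : h != 0 by near: h; exact: nbhs_dnbhs_neq.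
rewrite /= [h *: v + x]addrC fx -scalemxAr !dotv_linear /=.
by rewrite /GRing.scale /=; field.
Unshelve. all: by end_near. Qed.

Lemma convex_set_segment (X : set 'cV[R]_m) (y z : 'cV[R]_m) (t : R) :
  convex_set X -> X y -> X z -> 0 <= t <= 1 -> X (y + t *: (z - y)).
Proof.
move=> Xcvx Xy Xz /andP[t_ge0 t_le1].
have -> : y + t *: (z - y) = t *: z + (1 - t) *: y.
  rewrite scalerBl scale1r scalerBr addrCA; congr (_ + _).
exact: set_mem (Xcvx z y (Itv01 t_ge0 t_le1) (mem_set Xz) (mem_set Xy)).
Qed.

(** Dividing by [t] and letting [t] tend to [0] removes the quadratic term. *)
Lemma ge0_of_ge_quadratic (b q : R) :
  (forall t : R, 0 < t <= 1 -> - (t ^+ 2 * q) <= t * b) -> 0 <= b.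
Proof.
move=> H; rewrite leNgt; apply/negP => b_lt0.
have [q_le0|q_gt0] := leP q 0.
  by have := H 1; rewrite ltr01 /= => /(_ (lexx _)); rewrite expr1n !mul1r; lra.
(* Under [t * (2 * q) <= - b], the quadratic term is at most half of [- t * b]. *)
pose t := Num.min 1 (- b / (2 * q)).
have t_gt0 : 0 < t by rewrite lt_min ltr01 /= divr_gt0 //; lra.
have : 0 < t <= 1 by rewrite t_gt0 ge_min lexx.
move=> /H; rewrite expr2 -mulrA -mulrN ler_pM2l //.
have : t <= - b / (2 * q) by rewrite /t ge_min lexx orbT.
rewrite ler_pdivlMr; lra.
Qed.

End LineDerivatives.

(** * Games with quadratic losses *)

Section QuadraticGame.
Context {R : realType} {N : nat} {n_ : 'I_N -> nat}.
Local Notation profile := 'cV[R]_(\sum_(i < N) n_ i).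
Implicit Types (x y z : profile) (X : set profile) (A : forall i j, 'M[R]_(n_ i, n_ j)).

Lemma dotv_blocks x y : dotv x y = \sum_i dotv (submxcol x i) (submxcol y i).
Proof.
rewrite /dotv -{1}[x]submxcolK -{1}[y]submxcolK tr_mxcol mul_mxrow_mxcol.
by rewrite summxE.
Qed.

Lemma submxcol_mul_mxblock (B : forall i j, 'M[R]_(n_ i, n_ j)) y i :
  submxcol (\mxblock_(i, j) B i j *m y) i = \sum_j B i j *m submxcol y j.
Proof. by rewrite -{1}[y]submxcolK mul_mxblock_mxrow mxcolK. Qed.

Lemma submxcol_deviate x i u j :
  submxcol (deviate x u) j = dfwith (fun j => submxcol x j) i u j.
Proof. exact: mxcolK. Qed.

Lemma submxcolZ (t : R) x i : submxcol (t *: x) i = t *: submxcol x i.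
Proof. by apply/matrixP => j k; rewrite !mxE. Qed.

(** The cross term [x_l^T A_li x_i] has gradient [A_li^T x_l] in [x_i], hence
    the transposed blocks. *)
Definition pseudo_gradient_mx A : 'M[R]_(\sum_(i < N) n_ i) :=
  \mxblock_(i < N, j < N) (if i == j then A i j else (A j i)^T).

Lemma submxcol_pseudo_gradient_mx A x i :
  submxcol (pseudo_gradient_mx A *m x) i =
  A i i *m submxcol x i + \sum_(l < N | l != i) (A l i)^T *m submxcol x l.
Proof.
rewrite submxcol_mul_mxblock (bigD1 i) //= eqxx; congr (_ + _).
by apply: eq_bigr => l; rewrite eq_sym => /negPf ->.
Qed.

Lemma quadratic_lossE A i x :
  quadratic_loss A i x = 2^-1 * dotv (submxcol x i) (A i i *m submxcol x i)
  + \sum_(l < N | l != i) dotv (submxcol x l) (A l i *m submxcol x i).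
Proof.
by rewrite /quadratic_loss /dotv -mulmxA; under eq_bigr do rewrite -mulmxA.
Qed.

Lemma dotv_suml (m : nat) (I : finType) (P : pred I) (f : I -> 'cV[R]_m) v :
  dotv (\sum_(i | P i) f i) v = \sum_(i | P i) dotv (f i) v.
Proof.
apply: (big_morph (fun u => dotv u v)) => [u w|]; first exact: dotvDl.
by rewrite dotvC dotv0.
Qed.

(** Symmetry of the diagonal block merges its two first-order terms. *)
Lemma quadratic_loss_expansion A i x w :
  (A i i)^T = A i i ->
  quadratic_loss A i (deviate x (submxcol x i + w)) =
  quadratic_loss A i x + dotv (submxcol (pseudo_gradient_mx A *m x) i) w
  + dotv w ((2^-1 *: A i i) *m w).
Proof.
move=> AiiT; rewrite !quadratic_lossE submxcol_pseudo_gradient_mx.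
rewrite submxcol_deviate dfwithin.
have -> : \sum_(l < N | l != i) dotv (submxcol (deviate x (submxcol x i + w)) l)
                                     (A l i *m (submxcol x i + w)) =
  \sum_(l < N | l != i) dotv (submxcol x l) (A l i *m submxcol x i)
  + \sum_(l < N | l != i) dotv ((A l i)^T *m submxcol x l) w.
  rewrite -big_split /=; apply: eq_bigr => l li.
  by rewrite submxcol_deviate dfwithout 1?eq_sym // mulmxDr dotvDr -dotv_mulmxr.
rewrite [X in _ = _ + X + _]dotvDl dotv_suml !mulmxDr -scalemxAl !dotv_linear.
have -> : dotv w (A i i *m submxcol x i) = dotv (A i i *m submxcol x i) w.
  exact: dotvC.
have -> : dotv (submxcol x i) (A i i *m w) = dotv (A i i *m submxcol x i) w.
  by rewrite dotv_mulmxr AiiT.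
by field.
Qed.

Lemma pseudo_gradient_quadratic_loss A :
  (forall i, (A i i)^T = A i i) ->
  pseudo_gradient (quadratic_loss A) = mulmx (pseudo_gradient_mx A).
Proof.
move=> AT; apply/funext => x; apply/mxcolP => i; rewrite mxcolK.
apply: (@grad_quadratic _ _ _ _ _ (2^-1 *: A i i)) => w.
rewrite quadratic_loss_expansion //; congr (_ + _ + _).
rewrite -[in RHS](addr0 (submxcol x i)) quadratic_loss_expansion //.
by rewrite mulmx0 !dotv0 !addr0.
Qed.

(** The form of the pseudo-gradient is that of the coupling matrix plus those of
    the halved diagonal blocks, and the latter are values of the form of the
    coupling matrix at profiles supported on one player. *)
Lemma positive_definite_pseudo_gradient A :
  positive_definite (coupling_mx A) -> positive_definite (pseudo_gradient_mx A).
Proof.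
move=> Cpd.
have formE (M : 'M[R]_(\sum_(i < N) n_ i)) x : (x^T *m M *m x) 0 0 = dotv x (M *m x).
  by rewrite /dotv mulmxA.
have blocksE (B : forall i j, 'M[R]_(n_ i, n_ j)) x :
    dotv x (\mxblock_(i, j) B i j *m x)
    = \sum_i \sum_j dotv (submxcol x i) (B i j *m submxcol x j).
  rewrite dotv_blocks; apply: eq_bigr => i _; rewrite submxcol_mul_mxblock.
  by rewrite dotvC dotv_suml; apply: eq_bigr => j _; rewrite dotvC.
have C_ge0 x : 0 <= dotv x (coupling_mx A *m x).
  have [->|/Cpd/ltW] := eqVneq x 0; first by rewrite mulmx0 dotv0.
  by rewrite formE.
have Aii_ge0 i (u : 'cV_(n_ i)) : 0 <= dotv u (A i i *m u).
  have := C_ge0 (deviate 0 u); rewrite blocksE.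
  rewrite (bigD1 i) //= (bigD1 i) //= submxcol_deviate dfwithin eqxx.
  rewrite big1 ?addr0 => [|j ji]; last first.
    by rewrite submxcol_deviate dfwithout 1?eq_sym // submxcol0 mulmx0 dotv0.
  rewrite big1 ?addr0 => [|j ji]; last first.
    apply: big1 => k _; rewrite submxcol_deviate dfwithout 1?eq_sym //.
    by rewrite submxcol0 dotvC dotv0.
  by rewrite -scalemxAl dotvZr pmulr_rge0 // invr_gt0.
move=> x x0; rewrite formE.
have -> : dotv x (pseudo_gradient_mx A *m x) = dotv x (coupling_mx A *m x)
    + \sum_i 2^-1 * dotv (submxcol x i) (A i i *m submxcol x i).
  rewrite !blocksE [X in _ = X + _]exchange_big /= -big_split /=.
  apply: eq_bigr => i _; rewrite (bigD1 i) //= [in RHS](bigD1 i) //= !eqxx.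
  rewrite -scalemxAl dotvZr addrAC; congr (_ + _); first by field.
  apply: eq_bigr => j ji; rewrite eq_sym (negPf ji).
  by rewrite dotv_mulmxr trmxK dotvC.
rewrite ltr_pwDl //; first by rewrite -formE Cpd.
by rewrite sumr_ge0 // => i _; rewrite mulr_ge0 // invr_ge0.
Qed.

Lemma nikaido_isoda_quadratic_loss A (a : R) x y :
  (forall i, (A i i)^T = A i i) ->
  nikaido_isoda (quadratic_loss A) a x y =
  - dotv (pseudo_gradient_mx A *m x) (y - x)
  - (\sum_i dotv (submxcol (y - x) i) ((2^-1 *: A i i) *m submxcol (y - x) i)
     + a / 2 * dotv (y - x) (y - x)).
Proof.
move=> AT; rewrite !(dotv_blocks _ (y - x)) mulr_sumr -big_split /=.
rewrite -!sumrN -big_split /=; apply: eq_bigr => i _.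
have {1}-> : submxcol y i = submxcol x i + submxcol (y - x) i.
  by rewrite submxcolB addrC subrK.
rewrite quadratic_loss_expansion // sqr_eucl_norm.
have -> : submxcol x i - submxcol y i = - submxcol (y - x) i.
  by rewrite submxcolB opprB.
rewrite !dotv_linear; ring.
Qed.

(** The proximal inequality at the points [x_ k.+1 + t (z - x_ k.+1)] of [X] is,
    up to a term of order [t ^+ 2], [t] times the inequality to be shown. *)
Lemma proximal_point_vi_sequence A X (a : R) (r : nat -> R) (x_ : nat -> profile) :
  (forall i, (A i i)^T = A i i) -> convex_set X ->
  proximal_point_sequence (quadratic_loss A) X a r x_ ->
  proximal_vi_sequence (mulmx (pseudo_gradient_mx A)) X (fun k => (r k)^-1) x_.
Proof.
move=> AT Xcvx [Xx step]; split=> // k z Xz.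
set y := x_ k.+1; set h := z - y.
pose Q w := \sum_i dotv (submxcol w i) ((2^-1 *: A i i) *m submxcol w i)
            + a / 2 * dotv w w.
have QZ t w : Q (t *: w) = t ^+ 2 * Q w.
  rewrite /Q mulrDr mulr_sumr; congr (_ + _).
    by apply: eq_bigr => i _; rewrite submxcolZ -scalemxAr !dotv_linear; ring.
  by rewrite !dotv_linear; ring.
apply: (@ge0_of_ge_quadratic _ _ (Q h)) => t /andP[t_gt0 t_le1].
have Xt : X (y + t *: h).
  by apply: convex_set_segment (Xx _) Xz _ => //; rewrite (ltW t_gt0).
have := step k _ Xt; rewrite nikaido_isoda_quadratic_loss //.
clearbody h; rewrite -/y [y + _]addrC addrK -/(Q _) QZ !dotv_linear.
rewrite [dotv (x_ k) h]dotvC [dotv y h]dotvC; lra.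
Qed.

(** At a single equilibrium every vector is normal to the set of equilibria, so
    [x - xs] lies in both cones for every [x] in [X]; the vector of the unit ball
    in its own direction gives the bound. *)
Lemma weak_sharp_singleton (theta : 'I_N -> profile -> R) X (gamma : R) xs :
  weak_sharp theta X gamma -> normalized_NE theta X = [set xs] ->
  sharp_at (pseudo_gradient theta) X gamma xs.
Proof.
move=> sharp NE1 x Xx.
have NExs : normalized_NE theta X xs by rewrite NE1.
have [->|xxs] := eqVneq x xs.
  by rewrite subrr dotv0 /eucl_norm dotv0 sqrtr0 mulr0.
have d_gt0 : 0 < eucl_norm (x - xs) by rewrite eucl_norm_gt0 subr_eq0.
set d := eucl_norm _ in d_gt0 *.
have dE : dotv (x - xs) (x - xs) = d ^+ 2 by rewrite sqr_eucl_norm.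
have unit_ball : eucl_unit_ball (d^-1 *: (x - xs)).
  by rewrite /eucl_unit_ball /= eucl_normZ gtr0_norm ?invr_gt0 // mulVf ?gt_eqF.
have := sharp _ NExs _ (imageP _ unit_ball) _ NExs (x - xs).
have cones : (tangent_cone X xs `&` normal_cone (normalized_NE theta X) xs) (x - xs).
  split=> [v vN|_ [z + <-]]; first by rewrite dotvC; apply: vN; exists x.
  by rewrite NE1 => ->; rewrite subrr dotv0.
move=> /(_ cones).
rewrite dotvDl dotvNl dotvZl dotvZl dE expr2 mulKf ?gt_eqF //; lra.
Qed.

End QuadraticGame.

(** * Finite termination for the game *)

Theorem theorem5p2 (R : realType) (N : nat) (n_ : 'I_N -> nat)
  (X : set 'cV[R]_(\sum_(i < N) n_ i))
  (A : forall i j : 'I_N, 'M[R]_(n_ i, n_ j))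
  (delta gamma a eps : R) (r : nat -> R)
  (x_ : nat -> 'cV[R]_(\sum_(i < N) n_ i)) :
  X !=set0 -> closed X -> convex_set X ->
  (forall i, (A i i)^T = A i i) ->
  positive_definite (coupling_mx A) ->
  0 < delta ->
  smallest_eigenvalue (coupling_mx A + (coupling_mx A)^T) delta ->
  0 < gamma ->
  weak_sharp (quadratic_loss A) X gamma ->
  0 < a <= delta ->
  0 < eps ->
  (forall k, 0 < r k) ->
  (0 < limn_einf (fun k => (r k)%:E))%E ->
  (forall k, 0 < (r k)^-1 < eps) ->
  proximal_point_sequence (quadratic_loss A) X a r x_ ->
  exists k0 : nat,
    (forall k, (k0 + 1 <= k)%N -> normalized_NE (quadratic_loss A) X (x_ k)) /\
    k0%:R <= eucl_dist (x_ 0%N) (normalized_NE (quadratic_loss A) X) ^+ 2 * eps ^+ 2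
             / gamma ^+ 2.
Proof.
move=> _ Xcl Xcvx AT Cpd _ _ gamma_gt0 sharp _ _ _ _ r_bnd prox.
pose G := pseudo_gradient_mx A.
have Gpd : positive_definite G by exact: positive_definite_pseudo_gradient.
have gradE := pseudo_gradient_quadratic_loss AT.
have viprox := proximal_point_vi_sequence AT Xcvx prox.
have [xs xsP] := proximal_limit_vi_solution Xcl Gpd r_bnd viprox.
have NE1 : normalized_NE (quadratic_loss A) X = [set xs].
  rewrite /normalized_NE gradE.
  exact: vi_solutions_singleton Gpd xsP.
have sharpG := weak_sharp_singleton sharp NE1; rewrite gradE in sharpG.
have [k0 [k0P k0_le]] := proximal_finite_termination
  (positive_definite_monotone Gpd) gamma_gt0 r_bnd viprox xsP sharpG.
exists k0; rewrite NE1; split=> [k|]; first by rewrite addn1; exact: k0P.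
by rewrite /eucl_dist image_set1 inf1.
Qed.
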